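(* Let $M\in\mathcal{I}_1$ be bounded, with $M\neq\{1,2\}$ and $3\notin M$. Then $\max M\ge7$.
   Context: For a summable sequence $\mathbf{x}=(x_n)$ of positive reals, $\mathcal{A}(\mathbf{x})=\{\sum_{n\in A}x_n: A\subseteq\mathbb{N}\}$ is its achievement set and its cardinal function $f$ assigns to $x\in\mathcal{A}(\mathbf{x})$ the cardinality (a positive integer, $\omega$, or $\mathfrak{c}$) of $\{(\varepsilon_n)\in\{0,1\}^{\mathbb{N}}:\sum\varepsilon_nx_n=x\}$. $\mathcal{I}_1$ is the family of ranges of cardinal functions of such sequences whose achievement set is a single closed interval. A set $M\subseteq\{1,2,\dots\}\cup\{\omega,\mathfrak{c}\}$ is bounded if there is $N\in\mathbb{N}$ with $M\subseteq\{1,\dots,N\}$. *)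

(* Defs.v *)
From HB Require Import structures.
From mathcomp Require Import all_boot all_order all_algebra.
From mathcomp Require Import all_classical all_reals all_analysis.
Set Implicit Arguments. Unset Strict Implicit. Unset Printing Implicit Defensive.
Import Order.TTheory GRing.Theory Num.Theory numFieldNormedType.Exports.
Local Open Scope classical_set_scope.
Local Open Scope ring_scope.

Inductive cardv := CFin of nat | COmega | CCont.

Definition card_is {T} (S : set T) (c : cardv) : Prop :=
  match c with
  | CFin n => (S #= `I_n)%card
  | COmega => (S #= [set: nat])%card
  | CCont => (S #= [set: nat -> bool])%card
  end.

Definition subseq_sum (R : realType) (x : R^nat) (e : nat -> bool) : R^nat :=
  series (fun n => if e n then x n else 0).

Definition codes (R : realType) (x : R^nat) (y : R) : set (nat -> bool) :=
  [set e | subseq_sum x e @ \oo --> y].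

Definition achievement_set (R : realType) (x : R^nat) : set R :=
  [set y | exists e, subseq_sum x e @ \oo --> y].

Definition cardfun_range (R : realType) (x : R^nat) : set cardv :=
  [set c | exists2 y, achievement_set x y & card_is (codes x y) c].

Definition in_I1 (R : realType) (M : set cardv) : Prop :=
  exists x : R^nat,
    (forall n, 0 < x n) /\ cvgn (series x) /\
    (exists a b : R, a <= b /\ achievement_set x = `[a, b]%classic) /\
    cardfun_range x = M.

Definition bounded_cardset (M : set cardv) : Prop :=
  exists N : nat, M `<=` [set CFin k | k in [set k : nat | (1 <= k <= N)%N]].

(* Main.v *)
(* Reorder [x] nonincreasingly.  The achievement set being an interval forces
   every term to be at most the sum of the terms after it.  If the inequality is
   strict infinitely often, then for a Baire-generic [y] every code of [y] can be
   modified arbitrarily far out, so [y] has continuum many codes.  Otherwise the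
   sequence ends in a halving (geometric) tail with sum [s], where [y] in
   [0 < y < s] has two codes if it is dyadic in [s] and one if not.  If the
   inequality is never strict, the range is [{1, 2}].  Else let [a] be the last
   term with strict inequality and [k] its multiplicity: for small [z >= 0],
   [a + z] has [p + k q] codes, where [p] and [q] count the codes of [a + z] and
   [z] in the tail.  For [k >= 3] a dyadic [z] gives at least [1 + 3 * 2] codes;
   for [k = 1] or [k = 2], a suitable [z] ([0], dyadic or not, according to
   whether [a] is dyadic) gives exactly three. *)
Require Import Defs.
From mathcomp Require Import all_boot all_order all_algebra.
From mathcomp Require Import all_classical all_reals all_analysis.
From mathcomp Require Import zify ring lra.
Set Implicit Arguments. Unset Strict Implicit. Unset Printing Implicit Defensive.
Import Order.TTheory GRing.Theory Num.Theory numFieldNormedType.Exports.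
Local Open Scope classical_set_scope.
Local Open Scope ring_scope.

(** * Tails of sequences and sums selected by codes *)

Definition tl (T : Type) (u : nat -> T) (n : nat) : nat -> T :=
  fun i => u (n + i)%N.

Lemma tl_tl (T : Type) (u : nat -> T) m n : tl (tl u m) n = tl u (m + n).
Proof. by apply/funext => i; rewrite /tl addnA. Qed.

Lemma tl0 (T : Type) (u : nat -> T) : tl u 0 = u.
Proof. exact/funext. Qed.

Definition pos_summable (R : realType) (x : R^nat) :=
  (forall n, 0 < x n) /\ cvgn (series x).

(** [limn] makes this total in the code. For a positive summable sequence every selected series
    converges, so membership in [codes] becomes an equation on [csum]. *)
Definition csum (R : realType) (x : R^nat) (e : nat -> bool) : R :=
  limn (subseq_sum x e).

Definition total (R : realType) (x : R^nat) : R := csum x (fun=> true).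

Lemma subseq_sum_tl (R : realType) (x : R^nat) e n k :
  subseq_sum x e (n + k)%N =
  subseq_sum x e n + subseq_sum (tl x n) (tl e n) k.
Proof.
rewrite /subseq_sum /series /= (big_cat_nat (n := n)) //= ?leq_addr//.
congr (_ + _); rewrite -[X in \sum_(X <= _ < _) _]add0n big_addn addKn.
by apply: eq_bigr => i _; rewrite /tl addnC.
Qed.

Lemma subseq_sum_true (R : realType) (x : R^nat) :
  subseq_sum x (fun=> true) = series x.
Proof. by []. Qed.

Lemma pos_summable_tl (R : realType) (x : R^nat) n :
  pos_summable x -> pos_summable (tl x n).
Proof.
move=> [x0 cx]; split=> [i|]; first exact: x0.
rewrite -subseq_sum_true.
have -> : subseq_sum (tl x n) (fun=> true) =
   (fun k => subseq_sum x (fun=> true) (k + n)%N - subseq_sum x (fun=> true) n).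
  apply/funext => k; rewrite addnC subseq_sum_tl addrAC subrr add0r.
  by congr (subseq_sum _ _ _).
apply: is_cvgB; last exact: is_cvg_cst.
by apply: cvgP (limn (series x)) _; rewrite (cvg_shiftn n (series x)).
Qed.

Lemma subseq_sum_cvg (R : realType) (x : R^nat) e :
  pos_summable x -> cvgn (subseq_sum x e).
Proof.
move=> [x0 cx]; apply: (series_le_cvg _ _ _ cx) => n; do ?case: ifP => // _; exact: ltW.
Qed.

Lemma codesE (R : realType) (x : R^nat) y e :
  pos_summable x -> codes x y e <-> csum x e = y.
Proof.
move=> px; split=> [|<-]; first by move=> /cvg_lim; apply.
exact: subseq_sum_cvg.
Qed.

Lemma csum_tl (R : realType) (x : R^nat) e n : pos_summable x ->
  csum x e = subseq_sum x e n + csum (tl x n) (tl e n).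
Proof.
move=> px; apply: cvg_lim => //.
rewrite -(cvg_shiftn n).
under eq_fun do rewrite addnC subseq_sum_tl.
by apply: cvgD; [exact: cvg_cst|exact/subseq_sum_cvg/pos_summable_tl].
Qed.

Lemma subseq_sum1 (R : realType) (x : R^nat) e :
  subseq_sum x e 1%N = if e 0%N then x 0%N else 0.
Proof. by rewrite /subseq_sum /series /= big_nat1. Qed.

Lemma csum_tl1 (R : realType) (x : R^nat) e : pos_summable x ->
  csum x e = (if e 0%N then x 0%N else 0) + csum (tl x 1) (tl e 1).
Proof. by move=> px; rewrite (@csum_tl _ x e 1)// subseq_sum1. Qed.

Lemma csum_tlS (R : realType) (x : R^nat) e n : pos_summable x ->
  csum (tl x n) (tl e n) =
  (if e n then x n else 0) + csum (tl x n.+1) (tl e n.+1).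
Proof.
move=> px; rewrite csum_tl1; last exact: pos_summable_tl.
by rewrite !tl_tl addn1 /tl addn0.
Qed.

Lemma total_tl (R : realType) (x : R^nat) n : pos_summable x ->
  total (tl x n) = x n + total (tl x n.+1).
Proof.
exact: (@csum_tlS _ x (fun=> true)).
Qed.

Lemma le_csum (R : realType) (x : R^nat) (e d : nat -> bool) :
  pos_summable x -> (forall n, e n -> d n) -> csum x e <= csum x d.
Proof.
move=> px ed; apply: lim_series_le; do ?exact: subseq_sum_cvg.
move=> n; move: (ed n); case: (e n) => [->//|_].
by case: ifP => // _; apply: ltW; case: px.
Qed.

Lemma csum_false (R : realType) (x : R^nat) : csum x (fun=> false) = 0.
Proof.
apply: cvg_lim => //; rewrite (_ : subseq_sum _ _ = cst 0); first exact: cvg_cst.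
by apply/funext => n; rewrite /subseq_sum /series /= big1.
Qed.

Lemma csum_ge0 (R : realType) (x : R^nat) e : pos_summable x -> 0 <= csum x e.
Proof. by move=> px; rewrite -(csum_false x); apply: le_csum. Qed.

Lemma csum_le_total (R : realType) (x : R^nat) e :
  pos_summable x -> csum x e <= total x.
Proof. by move=> px; apply: le_csum. Qed.

Lemma csum_neg (R : realType) (x : R^nat) e : pos_summable x ->
  csum x (fun n => ~~ e n) = total x - csum x e.
Proof.
move=> px; apply/eqP; rewrite -subr_eq opprK addrC; apply/eqP.
rewrite -lim_seriesD; do ?exact: subseq_sum_cvg.
congr (limn (series _)); apply/funext => n /=.
by rewrite !fctE; case: (e n); rewrite ?addr0 ?add0r.
Qed.

Lemma subseq_sum_ge0 (R : realType) (x : R^nat) e n :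
  pos_summable x -> 0 <= subseq_sum x e n.
Proof.
move=> [x0 _]; rewrite /subseq_sum /series /=; apply: sumr_ge0 => i _.
by case: ifP => // _; apply: ltW.
Qed.

Lemma le_term_csum (R : realType) (x : R^nat) (e : nat -> bool) n :
  pos_summable x -> e n -> x n <= csum x e.
Proof.
move=> px en; rewrite (csum_tl _ n)// csum_tlS// en.
have := subseq_sum_ge0 e n px.
have := csum_ge0 (tl e n.+1) (pos_summable_tl n.+1 px).
lra.
Qed.

Lemma csum_eq0 (R : realType) (x : R^nat) (e : nat -> bool) :
  pos_summable x -> csum x e = 0 -> e = (fun=> false).
Proof.
move=> px v0; apply/funext => n; apply/negP => en.
by have := le_term_csum px en; rewrite v0 leNgt; case: px => ->.
Qed.

Lemma csum_eq_total (R : realType) (x : R^nat) (e : nat -> bool) :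
  pos_summable x -> csum x e = total x -> e = (fun=> true).
Proof.
move=> px vt; have /(csum_eq0 px) h : csum x (fun n => ~~ e n) = 0.
  by rewrite csum_neg// vt subrr.
by apply/funext => n; move/(congr1 (@^~ n)): h => /negbFE.
Qed.

Lemma total_gt0 (R : realType) (x : R^nat) : pos_summable x -> 0 < total x.
Proof.
move=> px; rewrite lt_neqAle csum_ge0// andbT eq_sym; apply/eqP => /(csum_eq0 px).
by move/(congr1 (@^~ 0%N)).
Qed.

Lemma total_tl_cvg0 (R : realType) (x : R^nat) :
  pos_summable x -> (fun n => total (tl x n)) @ \oo --> (0 : R).
Proof.
move=> px.
have -> : (fun n => total (tl x n)) = (fun n => total x - series x n).
  apply/funext => n; rewrite {2}/total (csum_tl _ n)// subseq_sum_true.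
  by rewrite addrAC subrr add0r.
rewrite -(subrr (total x)); apply: cvgB; [exact: cvg_cst|exact: px.2].
Qed.

Lemma total_tl_small (R : realType) (x : R^nat) (d : R) :
  pos_summable x -> 0 < d -> exists N, forall n, (N <= n)%N -> total (tl x n) < d.
Proof.
move=> px d0; have /cvgrPdist_lt/(_ _ d0) [N _ hN] := total_tl_cvg0 px.
exists N => n /hN; rewrite sub0r normrN; exact: le_lt_trans (ler_norm _).
Qed.

(** * Kakeya's condition and the greedy expansion *)

Definition interval_filling (R : realType) (x : R^nat) :=
  forall n, x n <= total (tl x n.+1).

Lemma interval_filling_tl (R : realType) (x : R^nat) n :
  interval_filling x -> interval_filling (tl x n).
Proof. by move=> kx i; rewrite tl_tl addnS; exact: kx. Qed.

Fixpoint greedy_rem (R : realType) (x : R^nat) (y : R) n : R :=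
  if n is m.+1 then
    let r := greedy_rem x y m in r - (if x m <= r then x m else 0)
  else y.

(** Greedy algorithm: a term is taken whenever it fits. The remainder stays between 0 and the total
    of the terms still to come: a skipped term exceeds the remainder and is itself at most the total
    after it. Since these totals tend to 0, so does the remainder. *)
Lemma interval_filling_csum (R : realType) (x : R^nat) (y : R) :
  pos_summable x -> interval_filling x -> 0 <= y <= total x ->
  exists e, csum x e = y.
Proof.
move=> px kx y0x.
have rP n : 0 <= greedy_rem x y n <= total (tl x n).
  elim: n => [|n /andP[r0 rt]] /=; first by rewrite tl0.
  have := kx n; move: rt; rewrite total_tl//.
  by case: (leP (x n) (greedy_rem x y n)) => *; apply/andP; split; lra.
exists (fun n => x n <= greedy_rem x y n).
have sE n : subseq_sum x (fun n => x n <= greedy_rem x y n) n = y - greedy_rem x y n.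
  rewrite /subseq_sum /series /=; elim: n => [|n IHn].
    by rewrite big_geq //= subrr.
  by rewrite big_nat_recr //= IHn; lra.
apply: cvg_lim => //; rewrite (funext sE) -[X in _ --> X]subr0.
apply: cvgB; first exact: cvg_cst.
apply: (@squeeze_cvgr _ _ _ _ (cst 0) (fun n => total (tl x n))).
- by near=> n; exact: rP.
- exact: cvg_cst.
- exact: total_tl_cvg0.
Unshelve. all: by end_near. Qed.

(** * Counting codes by their first digit *)

Definition bcons (b : bool) (e : nat -> bool) : nat -> bool :=
  fun n => if n is m.+1 then e m else b.

Lemma tl_bcons b e : tl (bcons b e) 1 = e.
Proof. exact/funext. Qed.

Lemma bconsK e : bcons (e 0%N) (tl e 1) = e.
Proof. by apply/funext => -[|n]. Qed.

Lemma card_eq_disjointU (T : choiceType) (A B : set T) p q :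
  (A #= `I_p)%card -> (B #= `I_q)%card -> A `&` B = set0 ->
  (A `|` B #= `I_(p + q))%card.
Proof.
move=> Ap Bq AB0.
have Af : finite_set A by apply/finite_setP; exists p.
have Bf : finite_set B by apply/finite_setP; exists q.
have ABf : finite_set (A `|` B) by rewrite finite_setU.
have [n ABn] : exists n, (A `|` B #= `I_n)%card by apply/finite_setP.
suff <- : n = (p + q)%N by [].
rewrite -(card_fset_set ABn) -(card_fset_set Ap) -(card_fset_set Bq).
rewrite fset_setU// finmap.cardfsU -fset_setI// AB0 fset_set0 finmap.cardfs0.
by rewrite subn0.
Qed.

Definition ncodes (R : realType) (x : R^nat) (y : R) (k : nat) :=
  (codes x y #= `I_k)%card.

(** The codes of [y] split by their first digit: digit 0 leaves [y] to the tail, digit 1 leaves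
    [y - x 0]. All later finite counts come from this recursion. *)
Lemma ncodes_tl (R : realType) (x : R^nat) (y : R) p q : pos_summable x ->
  ncodes (tl x 1) y p -> ncodes (tl x 1) (y - x 0%N) q -> ncodes x y (p + q).
Proof.
move=> px; rewrite /ncodes.
have px1 := pos_summable_tl 1 px.
have injb b (A : set (nat -> bool)) : {in A &, injective (bcons b)}.
  by move=> e d _ _ /(congr1 (fun e => tl e 1)); rewrite !tl_bcons.
set A := codes (tl x 1) y; set B := codes _ (y - _) => Ap Bq.
have -> : codes x y = [set bcons false e | e in A] `|` [set bcons true e | e in B].
  apply/seteqP; split=> [e /(codesE _ _ px)|e [|] [d]].
  - rewrite csum_tl1//; case e0: (e 0%N) => ye; [right|left];
      exists (tl e 1); rewrite -?e0 ?bconsK//; apply/codesE => //.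
      by rewrite -ye addrAC subrr add0r.
    by rewrite -ye add0r.
  - by move=> /(codesE _ _ px1) yd <-; apply/codesE => //; rewrite csum_tl1//= add0r.
  - by move=> /(codesE _ _ px1) yd <-; apply/codesE => //;
      rewrite csum_tl1// tl_bcons yd /= addrC subrK.
apply: card_eq_disjointU.
- by apply: card_eq_trans Ap; apply: inj_card_eq.
- by apply: card_eq_trans Bq; apply: inj_card_eq.
- by rewrite -subset0 => e [[d _ <-] [d' _ /(congr1 (@^~ 0%N))]].
Qed.

Lemma ncodes0 (R : realType) (x : R^nat) (y : R) :
  pos_summable x -> y < 0 \/ total x < y -> ncodes x y 0.
Proof.
move=> px hy; rewrite /ncodes II0 card_eq0; apply/eqP/seteqP; split=> // e.
move=> /(codesE _ _ px) ve; have := csum_ge0 e px; have := csum_le_total e px.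
by move=> h1 h2; case: hy => /=; rewrite -ve ltNge ?h1 ?h2.
Qed.

Lemma ncodes1 (R : realType) (x : R^nat) (y : R) e :
  pos_summable x -> csum x e = y -> (forall d, csum x d = y -> d = e) ->
  ncodes x y 1.
Proof.
move=> px ey u; rewrite /ncodes (_ : codes x y = [set e]) ?card_set1//.
apply/seteqP; split=> d; first by move=> /(codesE _ _ px) /u.
by move=> ->; apply/codesE.
Qed.

Lemma ncodes_zero (R : realType) (x : R^nat) : pos_summable x -> ncodes x 0 1.
Proof.
by move=> px; apply: (ncodes1 px (csum_false x)) => d; exact: csum_eq0.
Qed.

Lemma ncodes_total (R : realType) (x : R^nat) :
  pos_summable x -> ncodes x (total x) 1.
Proof. by move=> px; apply: (ncodes1 px erefl) => d; exact: csum_eq_total. Qed.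

(** * Halving sequences and dyadic values *)

Definition halving (R : realType) (x : R^nat) :=
  forall n, x n = total (tl x n.+1).

Lemma halving_tl (R : realType) (x : R^nat) n : halving x -> halving (tl x n).
Proof. by move=> hx i; rewrite tl_tl addnS; exact: hx. Qed.

Lemma halving_filling (R : realType) (x : R^nat) :
  halving x -> interval_filling x.
Proof. by move=> hx n; rewrite -hx. Qed.

(** Each term is half the previous one, so the sequence is geometric and a code of [y] amounts to a
    binary expansion of [y / total x]. *)
Lemma halvingE (R : realType) (x : R^nat) n : pos_summable x -> halving x ->
  x n * 2 ^+ n.+1 = total x.
Proof.
move=> px hx; elim: n => [|n IHn].
  by rewrite expr1 -[in RHS](tl0 x) total_tl// -hx mulr_natr mulr2n.
rewrite -IHn (hx n) total_tl// -hx exprS; lra.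
Qed.

(** Written without division; the natural numerator suffices because only nonnegative [y] occur. *)
Definition dyadic (R : realType) (s y : R) :=
  exists j q : nat, y * 2 ^+ j = q%:R * s.

Lemma dyadicD (R : realType) (s y z : R) :
  dyadic s y -> dyadic s z -> dyadic s (y + z).
Proof.
move=> [j [q yq]] [i [p zp]]; exists (j + i)%N, (q * 2 ^ i + p * 2 ^ j)%N.
rewrite natrD !natrM !natrX exprD mulrDl mulrDl.
have -> : y * (2 ^+ j * 2 ^+ i) = q%:R * s * 2 ^+ i by rewrite -yq; lra.
have -> : z * (2 ^+ j * 2 ^+ i) = p%:R * s * 2 ^+ j by rewrite -zp; lra.
lra.
Qed.

Lemma dyadicB (R : realType) (s y z : R) : 0 < s -> z <= y ->
  dyadic s y -> dyadic s z -> dyadic s (y - z).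
Proof.
move=> s0 zy [j [q yq]] [i [p zp]]; exists (j + i)%N, (q * 2 ^ i - p * 2 ^ j)%N.
have e1 : y * (2 ^+ j * 2 ^+ i) = q%:R * s * 2 ^+ i by rewrite -yq; lra.
have e2 : z * (2 ^+ j * 2 ^+ i) = p%:R * s * 2 ^+ j by rewrite -zp; lra.
rewrite natrB ?natrM ?natrX ?exprD; first by rewrite mulrBl e1 e2; lra.
(* The subtraction of numerators is not truncated, because [z <= y] and [0 < s]. *)
rewrite -(ler_nat R) !natrM !natrX -(ler_pM2r s0).
have : 0 <= (y - z) * (2 ^+ j * 2 ^+ i).
  by rewrite !mulr_ge0 ?subr_ge0// exprn_ge0.
rewrite mulrBl e1 e2; lra.
Qed.

Lemma dyadic_subseq_sum (R : realType) (x : R^nat) e n :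
  pos_summable x -> halving x -> dyadic (total x) (subseq_sum x e n).
Proof.
move=> px hx; rewrite /subseq_sum /series /=; elim: n => [|n IHn].
  by rewrite big_geq//; exists 0%N, 0%N; rewrite !mul0r.
rewrite big_nat_recr //=; apply: dyadicD => //; case: ifP => _; last first.
  by exists 0%N, 0%N; rewrite !mul0r.
by exists n.+1, 1%N; rewrite halvingE// mul1r.
Qed.

(** At the first place [n] where two codes of [y] differ, one takes [x n] and the other must make up
    for it with all later terms, whose total is exactly [x n]. Then [y] is a finite sum of terms,
    hence dyadic. *)
Lemma ncodes_nondyadic (R : realType) (x : R^nat) (y : R) :
  pos_summable x -> halving x -> 0 <= y <= total x -> ~ dyadic (total x) y ->
  ncodes x y 1.
Proof.
move=> px hx y0x ndy.
have [e ve] := interval_filling_csum px (halving_filling hx) y0x.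
apply: (ncodes1 px ve) => d vd; apply/funext; apply: contra_notP ndy => de.
have [n den dem] : exists2 n, d n != e n & forall m, (m < n)%N -> d m = e m.
  have ex : exists n, d n != e n.
    by move/existsNP: de => [n /eqP]; exists n.
  exists (ex_minn ex); first by case: ex_minnP.
  by case: ex_minnP => n _ h m mn; apply/eqP; apply: contraLR mn => /h; rewrite -leqNgt.
wlog {den} [dn en] : d e ve vd dem {de} / d n = true /\ e n = false.
  move=> wl; move: den; case dn: (d n); case en: (e n) => // _; first exact: (wl d e).
  by apply: (wl e d) => // m mn; rewrite dem.
move: vd; rewrite (csum_tl _ n)// => vd.
move: ve; rewrite (csum_tl _ n)// => ve.
have seq : subseq_sum x d n = subseq_sum x e n.
  rewrite /subseq_sum /series /= !big_nat.
  by apply: eq_bigr => i /andP[_ /dem ->].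
move: ve vd; rewrite seq (csum_tlS e n px) (csum_tlS d n px) dn en.
have := csum_le_total (tl e n.+1) (pos_summable_tl n.+1 px).
have := csum_ge0 (tl d n.+1) (pos_summable_tl n.+1 px).
rewrite -hx => *.
have -> : y = subseq_sum x e n + x n by lra.
apply: dyadicD; first exact: dyadic_subseq_sum.
by exists n.+1, 1%N; rewrite halvingE// mul1r.
Qed.

(** Induction on the exponent of the denominator: dropping the first term halves the total and
    lowers the exponent. If [y] differs from [x 0], the first digit is forced; if [y = x 0], the two
    codes are the first term alone and all the other terms. *)
Lemma ncodes_dyadic (R : realType) (x : R^nat) (y : R) :
  pos_summable x -> halving x -> 0 < y < total x -> dyadic (total x) y ->
  ncodes x y 2.
Proof.
move=> + + + [j [q]].
elim: j q x y => [|j IHj] q x y px hx /andP[y0 yx].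
  rewrite expr0 mulr1 => yq; move: y0 yx; rewrite yq.
  case: q yq => [|q] yq; first by rewrite mul0r ltxx.
  by move=> _; rewrite -[ltRHS]mul1r ltr_pM2r ?total_gt0// (ltr_nat R _ 1).
have p1 := pos_summable_tl 1 px; have h1 := halving_tl 1 hx.
have t1 : total x = x 0%N + x 0%N by rewrite -[in LHS](tl0 x) total_tl// -hx.
have x0 : total (tl x 1) = x 0%N by rewrite -hx.
move=> yq; have yq' : y * 2 ^+ j = q%:R * x 0%N.
  by move: yq; rewrite exprS t1; lra.
have [yx0|yx0|yx0] := ltgtP y (x 0%N).
- rewrite -(addn0 2%N); apply: ncodes_tl => //; last first.
    by apply: ncodes0 => //; left; rewrite subr_lt0.
  by apply: (IHj q); rewrite ?x0 ?y0.
- rewrite -(add0n 2%N); apply: ncodes_tl => //.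
    by apply: ncodes0 => //; right; rewrite x0.
  have [k kE] : exists k, q = (k + 2 ^ j)%N.
    exists (q - 2 ^ j)%N; rewrite subnK// -(ler_nat R) natrX.
    rewrite -(ler_pM2r (px.1 0%N)) -yq' mulrC ler_pM2r ?exprn_gt0//.
    exact: ltW.
  apply: (IHj k) => //; first by rewrite x0; apply/andP; split; lra.
  by rewrite x0 mulrBl yq' kE natrD natrX; lra.
- rewrite yx0 -[2%N]/(1 + 1)%N; apply: ncodes_tl => //.
    by rewrite -{1}x0; exact: ncodes_total.
  by rewrite subrr; exact: ncodes_zero.
Qed.

Lemma halving_small_dyadic (R : realType) (x : R^nat) (d : R) :
  pos_summable x -> halving x -> 0 < d ->
  exists z, [/\ 0 < z, z < d & dyadic (total x) z].
Proof.
move=> px hx d0; have [N hN] := total_tl_small px d0.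
exists (x N); split; first exact: px.1.
  by rewrite hx hN.
by exists N.+1, 1%N; rewrite halvingE// mul1r.
Qed.

(** Otherwise 3 would divide a power of 2. *)
Lemma third_nondyadic (R : realType) (s : R) : 0 < s -> ~ dyadic s (s / 3).
Proof.
move=> s0 [j [q /(congr1 (fun t => t / s * 3))]].
have -> : s / 3 * 2 ^+ j / s * 3 = (2 ^ j)%:R.
  by rewrite natrX; field; rewrite gt_eqF.
have -> : q%:R * s / s * 3 = (q * 3)%:R by rewrite natrM mulfK ?gt_eqF.
move=> /eqP; rewrite eqr_nat => /eqP h.
have : (3 %| 2 ^ j)%N by rewrite h dvdn_mull.
by rewrite Euclid_dvdX.
Qed.

Lemma halving_small_nondyadic (R : realType) (x : R^nat) (d : R) :
  pos_summable x -> halving x -> 0 < d ->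
  exists z, [/\ 0 < z, z < d & ~ dyadic (total x) z].
Proof.
move=> px hx d0; have [N hN] := total_tl_small px d0.
have xN := px.1 N; have xd := hN N.+1 (leqnSn N); rewrite -hx in xd.
exists (x N / 3); split; [lra|lra|] => -[j [q h]].
apply: (@third_nondyadic _ (total x) (total_gt0 px)).
exists j, (q * 2 ^ N.+1)%N; rewrite -[in LHS](halvingE N px hx) natrM natrX.
have -> : x N * 2 ^+ N.+1 / 3 * 2 ^+ j = x N / 3 * 2 ^+ j * 2 ^+ N.+1 by lra.
by rewrite h; lra.
Qed.

(** * Codes of values just above a term with strict inequality *)

Lemma ncodes_tlS (R : realType) (x : R^nat) (y : R) n p q : pos_summable x ->
  ncodes (tl x n.+1) y p -> ncodes (tl x n.+1) (y - x n) q ->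
  ncodes (tl x n) y (p + q).
Proof.
move=> px hp hq; apply: ncodes_tl; first exact: pos_summable_tl.
  by rewrite tl_tl addn1.
by rewrite tl_tl addn1 /tl addn0.
Qed.

(** Since [y < a + a], a code uses at most one of the [d] equal terms: [p] codes use none, and each
    choice of one gives [q]. *)
Lemma ncodes_constant_block (R : realType) (x : R^nat) (a : R) m :
  pos_summable x -> forall d n, (n + d = m.+1)%N ->
  (forall i, (n <= i <= m)%N -> x i = a) ->
  forall y p q, y < a + a ->
    ncodes (tl x m.+1) y p -> ncodes (tl x m.+1) (y - a) q ->
    ncodes (tl x n) y (p + d * q).
Proof.
move=> px; elim=> [|d IHd] n nd xa y p q ya hp hq.
  by move: nd; rewrite addn0 mul0n addn0 => ->.
have xn : x n = a by apply: xa; lia.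
have a0 : 0 < a by rewrite -xn; exact: px.1.
have xa' i : (n.+1 <= i <= m)%N -> x i = a by move=> ?; apply: xa; lia.
(* The last summand counts codes that take term [n]; a second copy of [a] would leave a negative
   remainder, which has 0 codes. *)
rewrite (_ : p + d.+1 * q = (p + d * q) + (q + d * 0))%N; last by lia.
apply: ncodes_tlS => //.
- by apply: IHd => //; lia.
- rewrite xn; apply: IHd => //; [lia|lra|].
  by apply: ncodes0; [exact: pos_summable_tl|left; lra].
Qed.

Lemma ncodes_below (R : realType) (x : R^nat) (y : R) k :
  pos_summable x -> forall n, (forall i, (i < n)%N -> y < x i) ->
  ncodes (tl x n) y k -> ncodes x y k.
Proof.
move=> px; elim=> [|n IHn] yx; first by rewrite tl0.
move=> h; apply: IHn; first by move=> i ?; apply: yx; lia.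
rewrite -(addn0 k); apply: ncodes_tlS => //; apply: ncodes0.
  exact: pos_summable_tl.
by left; rewrite subr_lt0; apply: yx.
Qed.

(* [k] is the multiplicity of [x m]; larger terms cannot occur in a code of
   [x m + z], and at most one of the [k] copies can. *)
Lemma ncodes_last_overlap (R : realType) (x : R^nat) m :
  pos_summable x -> nonincreasing_seq x -> x m < total (tl x m.+1) ->
  exists k d, [/\ (0 < k)%N, 0 < d, x m + d <= total (tl x m.+1) &
    forall z p q, 0 <= z < d ->
      ncodes (tl x m.+1) (x m + z) p -> ncodes (tl x m.+1) z q ->
      ncodes x (x m + z) (p + k * q)].
Proof.
move=> px dx xm.
have ex : exists j, x j == x m by exists m.
(* By monotonicity the terms from the first occurrence [j] to [m] all equal [x m], and the earlier
   ones are strictly larger. *)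
have [j xj jmin] : exists2 j, x j = x m & forall i, x i = x m -> (j <= i)%N.
  case: (ex_minnP ex) => j /eqP xj h; exists j => // i /eqP; exact: h.
have jm : (j <= m)%N by exact: jmin.
have [d [d0 dxm dS dj]] : exists d, [/\ 0 < d, d <= x m,
    x m + d <= total (tl x m.+1) & forall i, (i < j)%N -> x m + d <= x i].
  have [e e0 ej] : exists2 e, 0 < e & forall i, (i < j)%N -> x m + e <= x i.
    case: j xj jmin jm => [|j] xj jmin jm; first by exists 1.
    exists (x j - x m) => [|i ij].
      rewrite subr_gt0 lt_neqAle dx ?(ltnW jm)// andbT eq_sym.
      by apply/eqP => /jmin; rewrite ltnn.
    by rewrite addrC subrK dx.
  (* The three bounds exclude the larger terms, exclude a second copy of [x m], and keep [x m + d]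
     within reach of the tail. *)
  exists (Num.min e (Num.min (x m) (total (tl x m.+1) - x m))).
  rewrite !lt_min e0 px.1 subr_gt0 xm; split => //.
  - by rewrite !ge_min lexx orbT.
  - by rewrite -lerBrDl !ge_min lexx !orbT.
  - by move=> i /ej; rewrite -!lerBrDl ge_min => ->.
exists (m.+1 - j)%N, d; split=> //; first by rewrite subn_gt0.
move=> z p q /andP[z0 zd] hp hq.
apply: (ncodes_below px (n := j)).
  by move=> i /dj; apply: lt_le_trans; rewrite ltrD2l.
apply: (ncodes_constant_block (a := x m) px) hp _ => //; first by rewrite subnKC// ltnW.
- move=> i /andP[ji im]; apply/eqP.
  by rewrite eq_le; apply/andP; split; [rewrite -xj; exact: dx|exact: dx].
- by rewrite ltrD2l (lt_le_trans zd).
- by rewrite addrAC subrr add0r.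
Qed.

Lemma ncodes_three_or_seven (R : realType) (x : R^nat) m :
  pos_summable x -> nonincreasing_seq x -> x m < total (tl x m.+1) ->
  halving (tl x m.+1) ->
  exists y k, ncodes x y k /\ (k = 3 \/ 7 <= k)%N.
Proof.
move=> px dx xm hh; set h := tl x m.+1 in xm hh *; set s := total h in xm *.
have ph : pos_summable h := pos_summable_tl m.+1 px.
have x0 : 0 < x m := px.1 m.
have [k [d [k0 d0 dS H]]] := ncodes_last_overlap px dx xm.
rewrite -/h -/s in dS H.
have N2 y : 0 < y -> y < s -> dyadic s y -> ncodes h y 2.
  by move=> y0 ys; apply: ncodes_dyadic => //; rewrite y0.
have N1 y : 0 < y -> y < s -> ~ dyadic s y -> ncodes h y 1.
  by move=> y0 ys; apply: ncodes_nondyadic => //; rewrite !ltW.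
have s0 : 0 < s by lra.
have [z [z0 zd dz]] := halving_small_dyadic ph hh d0.
have [w [w0 wd dw]] := halving_small_nondyadic ph hh d0.
rewrite -/s in dz dw.
have cancel t u : 0 < t -> dyadic s (t + u) -> dyadic s u -> dyadic s t.
  by move=> t0 h1 h2; rewrite -(addrK u t); apply: dyadicB => //; lra.
have zs : z < s by lra.
have ws : w < s by lra.
have xzs : x m + z < s by lra.
have xws : x m + w < s by lra.
(* The choice [z = 0], which has a single code in the tail. *)
have h0 p : ncodes h (x m) p -> ncodes x (x m + 0) (p + k * 1).
  by move=> hp; apply: H; rewrite ?addr0 ?lexx//; exact: ncodes_zero.
case: k k0 H h0 => [|[|[|k]]] // _ H h0.
(* One copy: [2 + 1] with [z = 0] if [x m] is dyadic; otherwise a dyadic [z] keeps [x m + z]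
   nondyadic and gives [1 + 2]. *)
- have [dx0|dx0] := pselect (dyadic s (x m)).
    by exists (x m + 0), 3%N; split; [exact/(h0 2%N)/N2|left].
  exists (x m + z), 3%N; split; last by left.
  apply: (H z 1%N 2%N); [by rewrite zd ltW| |exact: N2].
  apply: N1 => //; first lra.
  by move=> /(cancel _ _ x0)/(_ dz).
(* Two copies: [1 + 2 * 1] in both cases, with [z = 0] if [x m] is nondyadic and with the nondyadic
   [w] otherwise. *)
- have [dx0|dx0] := pselect (dyadic s (x m)); last first.
    by exists (x m + 0), 3%N; split; [exact/(h0 1%N)/N1|left].
  exists (x m + w), 3%N; split; last by left.
  apply: (H w 1%N 1%N); [by rewrite wd ltW| |exact: N1].
  apply: N1 => //; first lra.
  by rewrite addrC => /(cancel _ _ w0)/(_ dx0).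
(* At least three copies: a dyadic [z] has two codes in the tail and [x m + z] at least one, so the
   count is at least [1 + 3 * 2]. *)
- have [p [p0 hp]] : exists p, (0 < p)%N /\ ncodes h (x m + z) p.
    have [dy|ndy] := pselect (dyadic s (x m + z)).
      by exists 2%N; split=> //; apply: N2 => //; lra.
    by exists 1%N; split=> //; apply: N1 => //; lra.
  exists (x m + z), (p + k.+3 * 2)%N; split.
    by apply: H => //; [rewrite zd ltW|exact: N2].
  by right; move: p0; clear; lia.
Qed.

(** * From code counts to the range of the cardinal function *)

Lemma ncodes_range (R : realType) (x : R^nat) (y : R) k :
  ncodes x y k -> (0 < k)%N -> cardfun_range x (CFin k).
Proof.
move=> hk k0; exists y => //.
have : codes x y !=set0.
  apply/set0P/eqP => c0; move: hk; rewrite /ncodes c0 card_eq_sym card_eq0.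
  by move/eqP/seteqP => [/(_ 0%N) /= /(_ k0)].
by move=> [e ye]; exists e.
Qed.

Lemma infinite_cantor : ~ finite_set [set: nat -> bool].
Proof.
apply/infiniteP; have inj : {in [set: nat] &, injective (fun n m : nat => n == m)}.
  by move=> n m _ _ /(congr1 (@^~ m)); rewrite eqxx => /eqP.
rewrite -(card_le_eql (inj_card_eq inj)); exact: subset_card_le.
Qed.

Lemma halving_range (R : realType) (x : R^nat) :
  pos_summable x -> halving x -> cardfun_range x = [set CFin 1; CFin 2].
Proof.
move=> px hx; apply/seteqP; split=> [c [y [e /(codesE _ _ px) ve]]|c].
- have [k [k12 hk]] : exists k, (k = 1 \/ k = 2)%N /\ ncodes x y k.
    have := csum_ge0 e px; rewrite ve le_eqVlt => /predU1P[<-|y0].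
      by exists 1%N; split; [left|exact: ncodes_zero].
    have := csum_le_total e px; rewrite ve le_eqVlt => /predU1P[->|yS].
      by exists 1%N; split; [left|exact: ncodes_total].
    have [dy|dy] := pselect (dyadic (total x) y).
      by exists 2%N; split; [right|apply: ncodes_dyadic => //; rewrite y0].
    by exists 1%N; split; [left|apply: ncodes_nondyadic => //; rewrite !ltW].
  move=> hc; suff -> : c = CFin k by case: k12 => ->; [left|right].
  have kf : finite_set (codes x y) by apply/finite_setP; exists k.
  case: c hc => [n| |] /= hc.
  + by congr CFin; apply/card_eq_II; rewrite -(card_eql hc).
  + by move: kf; rewrite (eq_finite_set hc) => /infinite_nat.
  + by move: kf; rewrite (eq_finite_set hc) => /infinite_cantor.
- case=> ->; first exact: ncodes_range (ncodes_zero px) _.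
  apply: (@ncodes_range _ _ (x 0%N)) => //; apply: ncodes_dyadic => //.
    rewrite px.1 -[in ltRHS](tl0 x) total_tl// ltrDl.
    exact/total_gt0/pos_summable_tl.
  by exists 1%N, 1%N; rewrite halvingE// mul1r.
Qed.

(** * Perfect sets of codes have the cardinality of the continuum *)

(* Along a branch [b] the state [(e, n)] is a point of [C] with the length of
   its already fixed prefix. *)
Fixpoint branch (f : (nat -> bool) -> nat -> (nat -> bool) * nat)
    (e0 : nat -> bool) (b : nat -> bool) (k : nat) : (nat -> bool) * nat :=
  if k is l.+1 then
    let s := branch f e0 b l in
    (if b l then (f s.1 s.2).1 else s.1, (f s.1 s.2).2.+1)
  else (e0, 0%N).

(** The hypotheses say that [C] is nonempty, closed and without isolated points. A binary tree of
    points of [C] then embeds the Cantor space into [C]; the other inequality is inclusion. *)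
Lemma perfect_card_cantor (C : set (nat -> bool)) :
  C !=set0 ->
  (forall e, (forall n, exists2 d, C d & forall i, (i < n)%N -> d i = e i) ->
    C e) ->
  (forall e n, C e ->
    exists d, [/\ C d, forall i, (i < n)%N -> d i = e i & d <> e]) ->
  (C #= [set: nat -> bool])%card.
Proof.
move=> [e0 Ce0] Ccl Cperf.
(* [g] sends a point and a prefix length to another point of [C] with the same prefix, together with
   a position where the two differ. *)
have /choice[g gP] : forall p : (nat -> bool) * nat,
    exists q : (nat -> bool) * nat, C p.1 ->
      [/\ C q.1, forall i, (i < p.2)%N -> q.1 i = p.1 i, (p.2 <= q.2)%N
        & q.1 q.2 != p.1 q.2].
  move=> [e n] /=; have [Ce|nCe] := pselect (C e); last by exists (e, n).
  have [d [Cd de ne]] := Cperf e n Ce.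
  have [k dk] : exists k, d k != e k.
    apply: contrapT => h; apply: ne; apply/funext => k.
    by apply/eqP; apply: contrapT => /negP dk; apply: h; exists k.
  exists (d, k) => _; split=> //=; rewrite leqNgt; apply: contra dk => kn.
  by rewrite de.
pose f e n := g (e, n).
have fP e n : C e -> [/\ C (f e n).1, forall i, (i < n)%N -> (f e n).1 i = e i,
   (n <= (f e n).2)%N & (f e n).1 (f e n).2 != e (f e n).2].
  by move=> Ce; exact: (gP (e, n)).
pose st b k := branch f e0 b k.
have stC b k : C (st b k).1.
  elim: k => [//|k IHk] /=; case: ifP => // _.
  by have [] := fP (st b k).1 (st b k).2 IHk.
have stlt b k : ((st b k).2 < (st b k.+1).2)%N.
  by rewrite /= ltnS; have [] := fP (st b k).1 (st b k).2 (stC b k).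
have stle b k : (k <= (st b k).2)%N.
  by elim: k => [//|k IHk]; exact: leq_ltn_trans IHk (stlt b k).
have stmono b k l : (k <= l)%N ->
    ((st b k).2 <= (st b l).2)%N /\
    forall i, (i < (st b k).2)%N -> (st b l).1 i = (st b k).1 i.
  elim: l => [|l IHl]; first by rewrite leqn0 => /eqP ->.
  rewrite leq_eqVlt ltnS => /predU1P[-> //|/IHl[n_kl IH]]; split.
    exact: leq_trans n_kl (ltnW (stlt b l)).
  move=> i ik; rewrite -IH//=; case: ifP => // _.
  have [_ h _ _] := fP (st b l).1 (st b l).2 (stC b l).
  by apply: h; exact: leq_trans ik n_kl.
(* The limit along the branch: after [i.+1] steps the fixed prefix has length at least [i.+1], so
   digit [i] no longer changes. *)
pose G b : nat -> bool := fun i => (st b i.+1).1 i.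
have GE b k i : (i < (st b k).2)%N -> G b i = (st b k).1 i.
  move=> ik; rewrite /G; have [ki|ik'] := leqP k i.+1.
    by have [_ ->] := stmono b _ _ ki.
  by have [_ ->] := stmono b _ _ (ltnW ik').
have GC b : C (G b).
  apply: Ccl => n; exists (st b n).1 => // i ni.
  by rewrite (GE b n)//; exact: leq_trans ni (stle b n).
have Ginj : injective G.
  move=> b c; apply: contra_eq => bc.
  have ex : exists k, b k != c k.
    apply: contrapT => h; move/eqP: bc; apply; apply/funext => k.
    by apply/eqP; apply: contrapT => /negP bk; apply: h; exists k.
  case: (ex_minnP ex) => k bck kmin.
  have bcE i : (i < k)%N -> b i = c i.
    by move=> ik; apply/eqP; apply: contraLR ik => /kmin; rewrite -leqNgt.
  have stE l : (l <= k)%N -> st b l = st c l.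
    elim: l => [//|l IHl] lk; rewrite /st /= -!/(st _ l).
    by rewrite (IHl (ltnW lk)) (bcE _ lk).
  (* At the first difference [k] of [b] and [c] one branch moves and the other stays. They disagree
     at the position given by [f], which the new prefix length already covers. *)
  have nlt := ltnSn (f (st b k).1 (st b k).2).2.
  apply/eqP => /(congr1 (@^~ (f (st b k).1 (st b k).2).2)).
  rewrite (GE b k.+1)// (GE c k.+1); last by rewrite /= -/(st c k) -stE.
  rewrite /= -!/(st _ k) -(stE k)//.
  have [_ _ _ /eqP h] := fP (st b k).1 (st b k).2 (stC b k).
  by move: bck; case: (b k); case: (c k) => // _ /esym.
rewrite card_eq_le; apply/andP; split; first exact: card_leT.
have inj : {in [set: nat -> bool] &, injective G} by move=> ? ? _ _ /Ginj.
rewrite -(card_le_eql (inj_card_eq inj)); apply: subset_card_le.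
by move=> _ [b _ <-].
Qed.

(** * Baire category and values with continuum many codes *)

Lemma eq_subseq_sum (R : realType) (x : R^nat) e d n :
  (forall i, (i < n)%N -> e i = d i) -> subseq_sum x e n = subseq_sum x d n.
Proof.
move=> ed; rewrite /subseq_sum /series /= !big_nat.
by apply: eq_bigr => i /andP[_ /ed ->].
Qed.

(** Codes that agree on [N] digits have sums at most [total (tl x N)] apart, and this bound tends to
    0. *)
Lemma codes_closed (R : realType) (x : R^nat) (y : R) e : pos_summable x ->
  (forall n, exists2 d, codes x y d & forall i, (i < n)%N -> d i = e i) ->
  codes x y e.
Proof.
move=> px h; apply/codesE => //; apply: contrapT => /eqP ney.
have : 0 < `|csum x e - y| by rewrite normr_gt0 subr_eq0.
move=> /(total_tl_small px)[N /(_ _ (leqnn N))].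
have [d /(codesE _ _ px) <- de] := h N.
rewrite !(csum_tl _ N px) (eq_subseq_sum x de).
have pN := pos_summable_tl N px.
have := csum_ge0 (tl e N) pN; have := csum_le_total (tl e N) pN.
have := csum_ge0 (tl d N) pN; have := csum_le_total (tl d N) pN.
move=> *; suff : `|subseq_sum x e N + csum (tl x N) (tl e N) -
  (subseq_sum x e N + csum (tl x N) (tl d N))| <= total (tl x N) by lra.
by rewrite ler_norml; apply/andP; split; lra.
Qed.

Definition splice (n : nat) (c d : nat -> bool) : nat -> bool :=
  fun i => if (i < n)%N then c i else d (i - n)%N.

Lemma csum_splice (R : realType) (x : R^nat) n c d : pos_summable x ->
  csum x (splice n c d) = subseq_sum x c n + csum (tl x n) d.
Proof.
move=> px; rewrite (csum_tl _ n px); congr (_ + csum _ _).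
  by apply: eq_subseq_sum => i ni; rewrite /splice ni.
by apply/funext => i; rewrite /tl /splice ltnNge leq_addr addKn.
Qed.

(* Either [y] is out of reach of the codes extending [w], or some extension of
   [w] leaves a remainder in an overlap [(x m, total (tl x m.+1))], so that the
   digit [m] can be chosen freely. *)
Definition branching (R : realType) (x : R^nat) (w : seq bool) : set R :=
  let s := subseq_sum x (nth false w) (size w) in
  [set y | y < s] `|` [set y | s + total (tl x (size w)) < y] `|`
  \bigcup_(p in [set p : (nat -> bool) * nat | [/\ (size w <= p.2)%N,
      forall i, (i < size w)%N -> p.1 i = nth false w i
      & x p.2 < total (tl x p.2.+1)]])
    [set` `]subseq_sum x p.1 p.2 + x p.2,
            subseq_sum x p.1 p.2 + total (tl x p.2.+1)[].

Lemma branching_open (R : realType) (x : R^nat) w : open (branching x w).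
Proof.
apply: openU; first by apply: openU; [exact: open_lt|exact: open_gt].
by apply: bigcup_open => p _; exact: interval_open.
Qed.

(** A point [y0] that the prefix [w] can reach has a code [c] extending [w]. Far out along [c],
    replacing the rest of the sum by the midpoint of an overlap moves [y0] very little. *)
Lemma branching_dense (R : realType) (x : R^nat) w :
  pos_summable x -> interval_filling x ->
  (forall N, exists2 n, (N <= n)%N & x n < total (tl x n.+1)) ->
  dense (branching x w : set R).
Proof.
move=> px kx xinf U [y0 Uy0] Uo.
set n := size w; set E := nth false w; set s := subseq_sum x E n.
have [ys|sy] := ltP y0 s; first by exists y0; split=> //; left; left.
have [ys|ys] := ltP (s + total (tl x n)) y0.
  by exists y0; split=> //; left; right.
have [e ve] : exists e, csum (tl x n) e = y0 - s.
  apply: interval_filling_csum; [exact: pos_summable_tl|exact: interval_filling_tl|].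
  by apply/andP; split; lra.
pose c := splice n E e.
have vc : csum x c = y0 by rewrite csum_splice// ve addrC subrK.
have /nbhs_ballP[r r0 rU] : nbhs y0 U by exact: open_nbhs_nbhs.
have [N hN] := total_tl_small px r0.
have [m nm xm] := xinf (maxn n N).
move: nm; rewrite geq_max => /andP[nm /hN tm].
exists (subseq_sum x c m + (x m + total (tl x m.+1)) / 2); split.
  apply: rU; rewrite /ball /= -vc (csum_tl _ m px) ltr_norml.
  have pm := pos_summable_tl m px.
  have := csum_ge0 (tl c m) pm; have := csum_le_total (tl c m) pm.
  rewrite total_tl// in tm *.
  by have := px.1 m; move=> *; apply/andP; split; lra.
right; exists (c, m).
  by split=> //= i ni; rewrite /c /splice ni.
by rewrite /= in_itv /=; apply/andP; split; lra.
Qed.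

(** By Baire some [y] strictly between 0 and the total lies in the branching sets of all finite
    words. Its set of codes is closed, and no code is isolated, so it has the cardinality of the
    continuum. *)
Lemma continuum_in_range (R : realType) (x : R^nat) :
  pos_summable x -> interval_filling x ->
  (forall N, exists2 n, (N <= n)%N & x n < total (tl x n.+1)) ->
  cardfun_range x CCont.
Proof.
move=> px kx xinf.
(* Finite words are enumerated by [pickle]; numbers that encode no word get the whole line. *)
pose F i : set R := if unpickle i is Some w then branching x w else setT.
have FP i : open (F i) /\ dense (F i).
  rewrite /F; case: unpickle => [w|].
    by split; [exact: branching_open|exact: branching_dense].
  by split; [exact: openT|move=> U [y Uy] _; exists y].
have [||y [/= y0x Fy]] := @Baire R R F FP [set` `]0, total x[].
- by exists (total x / 2); rewrite /= in_itv /=; have := total_gt0 px => ?;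
    apply/andP; split; lra.
- exact: interval_open.
move: y0x; rewrite in_itv /= => /andP[y0 yx].
have [e ve] : exists e, csum x e = y.
  by apply: interval_filling_csum => //; rewrite !ltW.
exists y; first by exists e; apply/codesE.
apply: perfect_card_cantor.
- by exists e; apply/codesE.
- by move=> d; exact: codes_closed.
move=> {e ve}e n /(codesE _ _ px) ve.
have := Fy (pickle (mkseq e n)) I; rewrite /F pickleK /branching.
rewrite size_mkseq (@eq_subseq_sum _ _ _ e) => [|i ni]; last by rewrite nth_mkseq.
have pn := pos_summable_tl n px.
have := csum_ge0 (tl e n) pn; have := csum_le_total (tl e n) pn.
move: ve; rewrite (csum_tl _ n px) => ve vt v0.
(* The code [e] itself extends its prefix, so [y] is not out of reach and must lie in an overlap at
   some [m >= n]. *)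
case=> [[/= ?|/= ?]|[[c m] /= [nm ce xm]]]; [by exfalso; lra|by exfalso; lra|].
rewrite in_itv /= => /andP[yl yr].
have pm := pos_summable_tl m.+1 px.
have km := interval_filling_tl m.+1 kx.
(* In the overlap both values of digit [m] can be completed; the value opposite to [e m] yields a
   code different from [e]. *)
have [d vd] : exists d, csum (tl x m.+1) d =
    y - subseq_sum x c m - (if ~~ e m then x m else 0).
  apply: interval_filling_csum => //; have := px.1 m.
  by case: (e m) => /= *; apply/andP; split; lra.
exists (splice m c (bcons (~~ e m) d)); split.
- apply/codesE => //; rewrite csum_splice// csum_tl1; last exact: pos_summable_tl.
  rewrite tl_bcons tl_tl addn1 vd /= /tl addn0; lra.
- by move=> i ni; rewrite /splice (leq_trans ni nm) ce// nth_mkseq.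
- move=> /(congr1 (@^~ m)); rewrite /splice ltnn subnn /=.
  by case: (e m).
Qed.

(** * Nonincreasing rearrangement *)

(** Repeatedly pick a largest term not yet picked. It exists, and every index is eventually picked,
    because only finitely many terms exceed a given positive bound. *)
Lemma sorting_reindex (R : realType) (x : R^nat) :
  (forall n, 0 < x n) -> x @ \oo --> (0 : R) ->
  exists s, bijective s /\ nonincreasing_seq (x \o s).
Proof.
move=> x0 xcvg.
have xsmall d : 0 < d -> exists N, forall n, (N <= n)%N -> x n < d.
  move=> d0; have /cvgrPdist_lt/(_ _ d0)[N _ hN] := xcvg.
  by exists N => n /hN; rewrite sub0r normrN; exact: le_lt_trans (ler_norm _).
have /choice[pick pickP] : forall l : seq nat, exists i, i \notin l /\
    forall j, j \notin l -> x j <= x i.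
  move=> l; pose j0 := (\max_(i <- l) i)%N.+1.
  have j0l : j0 \notin l.
    by apply/negP => jl; have := @leq_bigmax_seq _ l xpredT id j0 jl isT; rewrite ltnn.
  have [N hN] := xsmall (x j0) (x0 j0).
  have j0N : (j0 < N)%N by rewrite ltnNge; apply/negP => /hN; rewrite ltxx.
  pose P := [pred i : 'I_N | val i \notin l].
  case: (@Order.TotalTheory.arg_maxP _ _ _ (Ordinal j0N) P (fun i => x i)) => // i il imax.
  exists (val i); split=> // j jl; have [jN|Nj] := ltnP j N.
    exact: (imax (Ordinal jN)).
  by apply: le_trans (imax (Ordinal j0N) j0l); exact/ltW/hN.
pose pre := fix pre n := if n is m.+1 then rcons (pre m) (pick (pre m)) else [::].
pose s n := pick (pre n).
have preP n i : i \in pre n <-> exists2 m, (m < n)%N & i = s m.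
  elim: n => [|n IHn] /=; first by split=> // -[].
  rewrite mem_rcons inE; split=> [/predU1P[->|/IHn[m mn ->]]|[m]].
  - by exists n.
  - by exists m => //; exact: ltnW.
  - rewrite ltnS leq_eqVlt => /predU1P[->|mn] im; first by rewrite im eqxx.
    by apply/orP; right; apply/IHn; exists m.
have s_inj : injective s.
  have lt_neq m n : (m < n)%N -> s m <> s n.
    move=> mn smn; have [+ _] := pickP (pre n); move/negP; apply.
    by apply/preP; exists m.
  move=> m n smn; have [mn|nm|//] := ltngtP m n; first by case: (lt_neq _ _ mn).
  by case: (lt_neq _ _ nm).
(* If [i] were never picked, all picked terms would be at least [x i], which confines the injective
   [s] to finitely many indices. *)
have s_surj i : exists n, s n = i.
  apply: contrapT => h.
  have ix n : x i <= x (s n).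
    have [_] := pickP (pre n); apply; apply/negP => /preP[m _ im].
    by apply: h; exists m.
  have [N hN] := xsmall (x i) (x0 i).
  have sN n : (s n < N)%N.
    by rewrite ltnNge; apply/negP => /hN; rewrite ltNge ix.
  have inj : injective (fun n : 'I_N.+1 => Ordinal (sN n)).
    by move=> m n /(congr1 val)/s_inj/val_inj.
  by have := leq_card _ inj; rewrite !card_ord ltnn.
exists s; split.
  have /choice[t tP] := s_surj.
  by exists t => // n; apply: s_inj.
apply/nonincreasing_seqP => n /=; have [_] := pickP (pre n); apply.
apply/negP => /preP[m mn /s_inj smn]; move: mn; rewrite -smn.
by rewrite ltnNge leqnSn.
Qed.

(** The indices visited by [s] are distinct and lie in an initial segment; enlarging to the whole
    segment only adds nonnegative terms. *)
Lemma subseq_sum_reindex_le (R : realType) (x : R^nat) e (s : nat -> nat) n :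
  pos_summable x -> injective s ->
  subseq_sum (x \o s) (e \o s) n <= csum x e.
Proof.
move=> px sinj; set u := fun i => if e i then x i else 0.
have u0 i : 0 <= u i by rewrite /u; case: ifP => // _; exact/ltW/px.1.
pose r := map s (iota 0 n).
have -> : subseq_sum (x \o s) (e \o s) n = \sum_(j <- r) u j.
  by rewrite big_map /subseq_sum /series /= /index_iota subn0.
pose N := (\max_(i <- r) i)%N.+1.
have rN : perm_eq r [seq j <- iota 0 N | j \in r].
  apply: uniq_perm.
  - by rewrite map_inj_uniq ?iota_uniq.
  - by rewrite filter_uniq ?iota_uniq.
  - move=> j; rewrite mem_filter mem_iota /= add0n; case jr : (j \in r) => //=.
    by rewrite ltnS (@leq_bigmax_seq _ r xpredT id j).
rewrite (perm_big _ rN) big_filter /=.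
apply: (@le_trans _ _ (subseq_sum x e N)).
  rewrite /subseq_sum /series /= /index_iota subn0 big_mkcond /=.
  by apply: ler_sum => i _; case: ifP => // _; exact: u0.
by rewrite (csum_tl _ N px) lerDl; exact/csum_ge0/pos_summable_tl.
Qed.

Lemma pos_summable_reindex (R : realType) (x : R^nat) (s : nat -> nat) :
  pos_summable x -> injective s -> pos_summable (x \o s).
Proof.
move=> px sinj; have xs0 n : 0 < (x \o s) n by exact: px.1.
split=> //; apply: nondecreasing_is_cvgn.
  by apply/nondecreasing_seqP => n; rewrite -subr_ge0 seriesSB; exact: ltW.
exists (total x) => _ [n _ <-].
exact: (@subseq_sum_reindex_le _ x (fun=> true)).
Qed.

Lemma csum_reindex (R : realType) (x : R^nat) e (s : nat -> nat) :
  pos_summable x -> bijective s -> csum (x \o s) (e \o s) = csum x e.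
Proof.
move=> px [t st ts].
(* One inequality for every injection suffices: it is applied to [s] and then to its inverse [t]. *)
have le (y : R^nat) (d : nat -> bool) (f : nat -> nat) :
    pos_summable y -> injective f -> csum (y \o f) (d \o f) <= csum y d.
  move=> py finj; apply: limr_le.
    exact/subseq_sum_cvg/pos_summable_reindex.
  by near=> n; exact: subseq_sum_reindex_le.
apply/eqP; rewrite eq_le le//=; last exact: can_inj st.
have := le _ (e \o s) t (pos_summable_reindex px (can_inj st)) (can_inj ts).
have ->: (x \o s) \o t = x by apply/funext => n /=; rewrite ts.
by have ->: (e \o s) \o t = e by apply/funext => n /=; rewrite ts.
Unshelve. all: by end_near. Qed.

Lemma codes_reindex (R : realType) (x : R^nat) (s : nat -> nat) (y : R) :
  pos_summable x -> bijective s ->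
  codes (x \o s) y = [set e \o s | e in codes x y].
Proof.
move=> px sbij; have pxs := pos_summable_reindex px (bij_inj sbij).
apply/seteqP; split=> [d /(codesE _ _ pxs) vd|_ [e /(codesE _ _ px) ve <-]].
  have [t st ts] := sbij.
  have dE : d = (d \o t) \o s by apply/funext => n /=; rewrite st.
  exists (d \o t) => //; apply/codesE => //.
  by rewrite -vd -(csum_reindex _ px sbij) {2}dE.
by apply/codesE => //; rewrite csum_reindex.
Qed.

Lemma achievement_set_reindex (R : realType) (x : R^nat) (s : nat -> nat) :
  pos_summable x -> bijective s ->
  achievement_set (x \o s) = achievement_set x.
Proof.
move=> px sbij; apply/seteqP; split=> y [e xe].
  have : codes (x \o s) y e by [].
  by rewrite codes_reindex// => -[d xd _]; exists d.
exists (e \o s); suff : codes (x \o s) y (e \o s) by [].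
by rewrite codes_reindex//; exists e.
Qed.

Lemma cardfun_range_reindex (R : realType) (x : R^nat) (s : nat -> nat) :
  pos_summable x -> bijective s -> cardfun_range (x \o s) = cardfun_range x.
Proof.
move=> px sbij; rewrite /cardfun_range achievement_set_reindex//.
apply/seteqP; have h y : (codes (x \o s) y #= codes x y)%card.
  rewrite codes_reindex//; apply: inj_card_eq => e d _ _ ed.
  have [t _ ts] := sbij; apply/funext => n.
  by rewrite -(ts n); exact: (congr1 (@^~ (t n)) ed).
by split=> -[k| |] [y ? /= hy]; exists y => //=; move: hy; rewrite (card_eql (h y)).
Qed.

(** * Interval achievement sets and the conclusion *)

(** If [x n] exceeded the total [T] after it, no sum would fall strictly between [T] and [x n]:
    using an index up to [n] gives at least [x n] by monotonicity, and otherwise the sum is at most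
    [T]. The midpoint of this gap lies in the interval, which contains 0 and the total. *)
Lemma interval_achievement_filling (R : realType) (x : R^nat) (a b : R) :
  pos_summable x -> nonincreasing_seq x ->
  achievement_set x = `[a, b]%classic -> interval_filling x.
Proof.
move=> px dx xab n; rewrite leNgt; apply/negP => xn.
have mem e : csum x e \in `[a, b].
  have : `[a, b]%classic (csum x e) by rewrite -xab; exists e; exact/codesE.
  by [].
have := mem (fun=> false); have := mem (fun=> true).
rewrite csum_false -/(total x) !in_itv /= => /andP[_ tb] /andP[a0 _].
set T := total (tl x n.+1) in xn.
have T0 : 0 < T by exact/total_gt0/pos_summable_tl.
have xt : x n <= total x by exact: le_term_csum.
have : achievement_set x ((T + x n) / 2).
  by rewrite xab /= in_itv /=; apply/andP; split; lra.
move=> [e /(codesE _ _ px) ve].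
have [[i [ine ei]]|h] := pselect (exists i, (i <= n)%N /\ e i).
  have := le_term_csum px ei; have : x n <= x i by exact: dx.
  by rewrite ve; lra.
have := csum_le_total (tl e n.+1) (pos_summable_tl n.+1 px).
move: ve; rewrite (csum_tl _ n.+1 px) (@eq_subseq_sum _ _ _ (fun=> false)).
  rewrite {1}/subseq_sum /series /= big1 ?add0r// => ->; rewrite -/T; lra.
by move=> i ni; apply/negP => ei; apply: h; exists i.
Qed.

Theorem theorem7p4 (R : realType) (M : set cardv) :
  in_I1 R M -> bounded_cardset M ->
  M <> [set CFin 1; CFin 2] -> ~ M (CFin 3) ->
  exists2 k : nat, (7 <= k)%N & M (CFin k).
Proof.
move=> [x' [x'0 [cx' [[a [b [_ xab]]] rx]]]] [B MB] M12 M3.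
(* Sorting the sequence changes neither its achievement set nor its range. *)
have px' : pos_summable x' by [].
have [s [sbij dx]] := sorting_reindex x'0 (cvg_series_cvg_0 cx').
have px := pos_summable_reindex px' (bij_inj sbij).
rewrite -(cardfun_range_reindex px' sbij) in rx.
rewrite -(achievement_set_reindex px' sbij) in xab.
move: (x' \o s) dx px rx xab => {x' x'0 cx' px' s sbij} x dx px rx xab.
have kx := interval_achievement_filling px dx xab.
have [N hN] : exists N, forall n, (N <= n)%N -> x n = total (tl x n.+1).
  apply: contrapT => h; have : M CCont.
    rewrite -rx; apply: continuum_in_range => // N.
    apply: contrapT => h'; apply: h; exists N => n Nn.
    apply/eqP; rewrite eq_le kx /= leNgt; apply/negP => xn.
    by apply: h'; exists n.
  by move=> /MB[].
have [ex|nex] := pselect (exists n, x n < total (tl x n.+1)); last first.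
  case: M12; rewrite -rx; apply: halving_range => // n.
  apply/eqP; rewrite eq_le kx /= leNgt; apply/negP => xn.
  by apply: nex; exists n.
have exN n : x n < total (tl x n.+1) -> (n <= N)%N.
  by move=> xn; rewrite leqNgt; apply/negP => /ltnW/hN xE; rewrite -xE ltxx in xn.
(* [m] is the last index with strict inequality, so the tail after it is halving. *)
case: (ex_maxnP ex exN) => m xm mmax.
have hm : halving (tl x m.+1).
  move=> i; rewrite tl_tl; apply/eqP; rewrite eq_le addnS kx /= leNgt.
  by apply/negP => /mmax; rewrite leqNgt ltnS leq_addr.
have [y [k [yk k37]]] := ncodes_three_or_seven px dx xm hm.
have Mk : M (CFin k) by rewrite -rx; apply: ncodes_range yk _; lia.
by case: k37 => [k3|k7]; [rewrite k3 in Mk|exists k].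
Qed.
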